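(* Suppose that $h:\mathbb C\to\mathbb R$ is continuous. The following are equivalent: (i) There is a constant $C<\infty$, possibly depending on $h$, such that $|\mathcal R_h(\mathbf z)|\le C$ for any three-tuple $\mathbf z=\{z_1,z_2,z_3\}$ of non-collinear points in $\mathbb C$. (ii) $\mathcal R_h(\mathbf z)=0$ for any three-tuple $\mathbf z$ of non-collinear points in $\mathbb C$. (iii) $h$ is constant.
   Context: For $h:\mathbb C\to\mathbb R$, let $K_h(w,z)=\frac{e^{ih(w)}}{w-z}$ for $w\neq z$ in $\mathbb C$. For a kernel $K(w,z)$ defined for $w\ne z$ and a three-tuple $\mathbf z=\{z_1,z_2,z_3\}$ of distinct points in $\mathbb C$, the symmetrized form is $$\mathtt S[K](\mathbf z):=\sum_{\sigma\in S_3}K(z_{\sigma(1)},z_{\sigma(2)})\,\overline{K(z_{\sigma(1)},z_{\sigma(3)})},$$ where $S_3$ is the group of permutations of $\{1,2,3\}$. The Menger curvature $c(\mathbf z)$ of three non-collinear points is the reciprocal of the radius of the unique circle passing through them; $c^2(\mathbf z)=(c(\mathbf z))^2$. The function $\mathcal R_h$ is defined on three-tuples $\mathbf z$ of non-collinear points by the identity $$\mathtt S[\mathrm{Re}\,K_h](\mathbf z)=c^2(\mathbf z)\left(\tfrac12+\mathcal R_h(\mathbf z)\right),$$ where $\mathrm{Re}\,K_h$ is the real part of the kernel $K_h$. *)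

(* Defs.v *)
From mathcomp Require Import all_boot all_order all_algebra all_fingroup.
From mathcomp Require Import boolp classical_sets reals topology normedtype trigo.
From mathcomp Require Import complex ring.

Set Implicit Arguments.
Unset Strict Implicit.
Unset Printing Implicit Defensive.

Import Order.TTheory GRing.Theory Num.Theory.
Import numFieldNormedType.Exports.

Local Open Scope ring_scope.
Local Open Scope complex_scope.

Section Definitions.
Variable R : realType.

(* exp(i t), by Euler's formula *)
Definition expi (t : R) : R[i] := cos t +i* sin t.

(* Kernels are total functions; [x / 0 = 0] in MathComp, but the diagonal
   [w = z] is never reached on triples of distinct points. *)
Definition Kh (h : R[i] -> R) (w z : R[i]) : R[i] := expi (h w) / (w - z).

Definition ReK (K : R[i] -> R[i] -> R[i]) (w z : R[i]) : R[i] :=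
  (complex.Re (K w z))%:C.

(* The indices 0, 1, 2 : 'I_3 stand for 1, 2, 3. *)
Definition symm_form (K : R[i] -> R[i] -> R[i]) (z : 'I_3 -> R[i]) : R[i] :=
  \sum_(s : 'S_3) K (z (s 0)) (z (s 1)) * (K (z (s 0)) (z (s 2%:R)))^*.

Definition collinear (z : 'I_3 -> R[i]) : Prop :=
  exists a b : R[i], b != 0 /\ forall j, exists t : R, z j = a + t%:C * b.

Definition on_circle (z : 'I_3 -> R[i]) (o : R[i]) (r : R) : Prop :=
  0 < r /\ forall j, `|z j - o| = r%:C.

(* The default value 0 is only taken when no circle passes through the three
   points; see [circumcircle_unique] and [circumradiusP]. *)
Definition circumradius (z : 'I_3 -> R[i]) : R :=
  xget 0 [set r | exists o, on_circle z o r].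

Definition menger_curvature (z : 'I_3 -> R[i]) : R := (circumradius z)^-1.

(* The identity S[Re K_h] = c^2 (1/2 + R_h) solved for R_h. The left-hand side
   is a complex number with zero imaginary part; see [RhE]. *)
Definition Rh (h : R[i] -> R) (z : 'I_3 -> R[i]) : R :=
  complex.Re (symm_form (ReK (Kh h)) z) / menger_curvature z ^+ 2 - 2^-1.

End Definitions.

Section Wellformedness.
Variable R : realType.
Implicit Types (z : 'I_3 -> R[i]) (h : R[i] -> R).

Let x z j := complex.Re (z j).
Let y z j := complex.Im (z j).
Let D z := (x z 1 - x z 0) * (y z 2%:R - y z 0)
         - (x z 2%:R - x z 0) * (y z 1 - y z 0).

Let ord3 (P : 'I_3 -> Prop) : P 0 -> P 1 -> P 2%:R -> forall j, P j.
Proof.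
move=> P0 P1 P2 [[|[|[|//]]] jlt].
- by have -> : Ordinal jlt = 0 by apply: val_inj.
- by have -> : Ordinal jlt = 1 by apply: val_inj.
- by have -> : Ordinal jlt = 2%:R by apply: val_inj.
Qed.

Let collinear_D0 z : D z = 0 -> collinear z.
Proof.
move=> D0.
have main (u v w : R[i]) : v != u ->
    (complex.Re v - complex.Re u) * (complex.Im w - complex.Im u)
    - (complex.Re w - complex.Re u) * (complex.Im v - complex.Im u) = 0 ->
    exists t : R, w = u + t%:C * (v - u).
  case: u v w => [u1 u2] [v1 v2] [w1 w2] /=.
  move=> vu /eqP; rewrite subr_eq0 => /eqP E.
  have [p0|p0] := eqVneq (v1 - u1) 0.
    have q0 : v2 - u2 != 0.
      apply: contra vu; rewrite !subr_eq0 => /eqP ->.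
      by move/eqP: p0; rewrite subr_eq0 => /eqP ->.
    exists ((w2 - u2) / (v2 - u2)); apply/eqP.
    rewrite eq_complex /= p0 !mul0r !mulr0 !subr0 !addr0 divfK//.
    move: E; rewrite p0 mul0r => /esym/eqP.
    rewrite mulf_eq0 (negbTE q0) orbF subr_eq0 => /eqP ->.
    by rewrite !eqxx /= addrC subrK eqxx.
  exists ((w1 - u1) / (v1 - u1)); apply/eqP.
  rewrite eq_complex /= !mul0r subr0 addr0 divfK// mulrAC -E.
  by rewrite mulrAC divff// mul1r (addrC u1) (addrC u2) !subrK !eqxx.
have [e1|n1] := eqVneq (z 1) (z 0).
  have [e2|n2] := eqVneq (z 2%:R) (z 0).
    exists (z 0), 1; split; first exact: oner_neq0.
    by apply: ord3; exists 0; rewrite mul0r addr0.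
  exists (z 0), (z 2%:R - z 0); split; first by rewrite subr_eq0.
  apply: ord3; [exists 0 | exists 0 | exists 1] => //;
    by rewrite ?mul0r ?addr0 ?mul1r 1?addrC ?subrK.
exists (z 0), (z 1 - z 0); split; first by rewrite subr_eq0.
apply: ord3; [by exists 0; rewrite mul0r addr0 | |].
  by exists 1; rewrite mul1r addrC subrK.
exact: main.
Qed.

Let normE (u : R[i]) (r : R) : 0 < r ->
  `|u| = r%:C <-> complex.Re u ^+ 2 + complex.Im u ^+ 2 = r ^+ 2.
Proof.
move=> r0; rewrite normc_def; split=> [[]|] E.
  by rewrite -E sqr_sqrtr// addr_ge0// sqr_ge0.
by rewrite E sqrtr_sqr gtr0_norm.
Qed.

Lemma circumcircle_unique z : ~ collinear z ->
  exists! c : R[i] * R, on_circle z c.1 c.2.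
Proof.
move=> ncz; have D0 : D z != 0 by apply/eqP => /collinear_D0.
pose p1 := x z 1 - x z 0; pose q1 := y z 1 - y z 0.
pose p2 := x z 2%:R - x z 0; pose q2 := y z 2%:R - y z 0.
pose a := ((p1 ^+ 2 + q1 ^+ 2) * q2 - (p2 ^+ 2 + q2 ^+ 2) * q1) / (2 * D z).
pose b := ((p2 ^+ 2 + q2 ^+ 2) * p1 - (p1 ^+ 2 + q1 ^+ 2) * p2) / (2 * D z).
have D2 : 2 * D z != 0 by rewrite mulf_neq0// pnatr_eq0.
pose o := (x z 0 + a) +i* (y z 0 + b); pose r := Num.sqrt (a ^+ 2 + b ^+ 2).
have E1 : 2 * (p1 * a + q1 * b) = p1 ^+ 2 + q1 ^+ 2.
  by rewrite /a /b; move: D0; rewrite /D -/p1 -/p2 -/q1 -/q2 => D0; field.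
have E2 : 2 * (p2 * a + q2 * b) = p2 ^+ 2 + q2 ^+ 2.
  by rewrite /a /b; move: D0; rewrite /D -/p1 -/p2 -/q1 -/q2 => D0; field.
have r0 : 0 < r.
  rewrite sqrtr_gt0 lt_neqAle addr_ge0 ?sqr_ge0// andbT eq_sym.
  apply: contra D0; rewrite paddr_eq0 ?sqr_ge0// !sqrf_eq0 => /andP[/eqP a0 /eqP b0].
  move: E1; rewrite a0 b0 !mulr0 addr0 mulr0 => /esym/eqP.
  rewrite paddr_eq0 ?sqr_ge0// !sqrf_eq0 => /andP[/eqP p10 /eqP q10].
  by rewrite /D -/p1 -/q1 p10 q10 mul0r mulr0 subrr.
have r2 : r ^+ 2 = a ^+ 2 + b ^+ 2 by rewrite sqr_sqrtr// addr_ge0// sqr_ge0.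
have ReB (u v : R[i]) : complex.Re (u - v) = complex.Re u - complex.Re v.
  by case: u v => [? ?] [].
have ImB (u v : R[i]) : complex.Im (u - v) = complex.Im u - complex.Im v.
  by case: u v => [? ?] [].
exists (o, r); split => /=.
  split=> //; apply: ord3; apply/normE => //; rewrite r2 ReB ImB /=.
  - by rewrite -/(x z 0) -/(y z 0); ring.
  - transitivity (p1 ^+ 2 + q1 ^+ 2 - 2 * (p1 * a + q1 * b) + (a ^+ 2 + b ^+ 2)).
      by rewrite /p1 /q1 -/(x z 1) -/(y z 1); ring.
    by rewrite E1 subrr add0r.
  - transitivity (p2 ^+ 2 + q2 ^+ 2 - 2 * (p2 * a + q2 * b) + (a ^+ 2 + b ^+ 2)).
      by rewrite /p2 /q2 -/(x z 2%:R) -/(y z 2%:R); ring.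
    by rewrite E2 subrr add0r.
move=> [o' r'] /= [r'0 H].
pose a' := complex.Re o' - x z 0; pose b' := complex.Im o' - y z 0.
have /(normE _ r'0) H0 := H 0; have /(normE _ r'0) H1 := H 1.
have /(normE _ r'0) H2 := H 2%:R.
rewrite !ReB !ImB -/(x z _) -/(y z _) in H0 H1 H2.
have r'2 : r' ^+ 2 = a' ^+ 2 + b' ^+ 2 by rewrite -H0 /a' /b'; ring.
have F1 : 2 * (p1 * a' + q1 * b') = p1 ^+ 2 + q1 ^+ 2.
  apply/eqP; rewrite -subr_eq0; apply/eqP; transitivity (r' ^+ 2 - r' ^+ 2).
    by rewrite -{1}H0 -H1 /p1 /q1 /a' /b'; ring.
  exact: subrr.
have F2 : 2 * (p2 * a' + q2 * b') = p2 ^+ 2 + q2 ^+ 2.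
  apply/eqP; rewrite -subr_eq0; apply/eqP; transitivity (r' ^+ 2 - r' ^+ 2).
    by rewrite -{1}H0 -H2 /p2 /q2 /a' /b'; ring.
  exact: subrr.
have aa : a' = a.
  apply: (mulIf D2); rewrite /a divfK// -F1 -F2 /D -/p1 -/p2 -/q1 -/q2; ring.
have bb : b' = b.
  apply: (mulIf D2); rewrite /b divfK// -F1 -F2 /D -/p1 -/p2 -/q1 -/q2; ring.
have oo : o' = o.
  rewrite /o -aa -bb /a' /b' [x z 0 + _]addrC [y z 0 + _]addrC !subrK.
  by case: (o').
have rr : r' = r by rewrite /r -aa -bb -r'2 sqrtr_sqr gtr0_norm.
by rewrite oo rr.
Qed.

Lemma circumradiusP z : ~ collinear z -> exists o, on_circle z o (circumradius z).
Proof.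
move=> /circumcircle_unique[[o r] [/= zor _]].
rewrite /circumradius; case: xgetP => [r' _ //|/(_ r) /=].
by case; exists o.
Qed.

Lemma menger_curvature_gt0 z : ~ collinear z -> 0 < menger_curvature z.
Proof. by move=> /circumradiusP[o [r0 _]]; rewrite invr_gt0. Qed.

Lemma RhE h z : ~ collinear z ->
  symm_form (ReK (Kh h)) z =
  (menger_curvature z ^+ 2 * (2^-1 + Rh h z))%:C.
Proof.
move=> /menger_curvature_gt0 c0.
rewrite /Rh addrC subrK mulrC divfK ?expf_neq0 ?gt_eqF//.
suff [u ->] : exists u : R, symm_form (ReK (Kh h)) z = u%:C by [].
exists (\sum_(s : 'S_3) complex.Re (Kh h (z (s 0)) (z (s 1)))
                       * complex.Re (Kh h (z (s 0)) (z (s 2%:R)))).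
rewrite rmorph_sum; apply: eq_bigr => s _.
rewrite /ReK rmorphM; congr (_ * _).
by apply/eqP; rewrite eq_complex /= oppr0 !eqxx.
Qed.

End Wellformedness.

(* Main.v *)
Require Import Defs.
From mathcomp Require Import all_boot all_order all_algebra.
From mathcomp Require Import reals topology normedtype complex.
From mathcomp Require Import all_fingroup boolp classical_sets trigo realfun.
From mathcomp Require Import ring lra.
Import Order.TTheory GRing.Theory Num.Theory numFieldNormedType.Exports.
Local Open Scope ring_scope.

(** Write [u(w) = exp(i h(w))], a unit vector of the plane, and [<.,.>] for the
    real scalar product. Then [Re K_h(w, z) = <u(w), w - z> / |w - z|^2], so that
    over the common denominator [P], the product of the squared side lengths of
    the triangle,

      [S[Re K_h](z) = 2 N / P],
      [N = \sum_j <u(z_j), z_j - z_k> <u(z_j), z_j - z_l> |z_k - z_l|^2].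

    On the other hand [c^2(z) = 4 D^2 / P], where [D] is twice the signed area of
    the triangle. Hence [R_h(z) = N / (2 D^2) - 1/2] ([Rh_symm_numer]).

    If [h] is constant, then [N = D^2] is a polynomial identity, and [R_h = 0].

    Conversely, if [|R_h| <= C] then [|N| <= (2 C + 1) D^2]. As [N] is continuous
    and every collinear triple of points that are not all equal is a limit of
    non-collinear ones, [N] vanishes on collinear triples. On a line with
    direction [d], the vanishing of [N] says that [<u, d>^2] is an affine
    function of the position; being nonnegative on the whole line, it is
    constant ([proj_line]). Finitely many directions now suffice: horizontal and
    vertical lines show that [cos^2 h] is constant on the plane, and the two
    families of diagonal lines show the same for [cos h sin h]. So
    [sin (h(a) - h(b)) = 0] for all [a] and [b] ([sin_subr_eq0]): the values of
    [h] differ by multiples of [pi], and [h] is constant by continuity. *)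

(** * Sums over the permutations of three indices *)

Lemma sum_perm3 (V : nmodType) (F : 'I_3 -> 'I_3 -> 'I_3 -> V) :
  \sum_(s : 'S_3) F (s 0) (s 1) (s 2%:R) =
    F 0 1 2%:R + F 0 2%:R 1 + F 1 0 2%:R + F 1 2%:R 0
    + F 2%:R 0 1 + F 2%:R 1 0.
Proof.
pose t i : 'S_3 := tperm 0 i.
pose l : seq 'S_3 := [:: 1%g; tperm 1 2%:R; t 1; mulg (t 1) (t 2%:R);
                      mulg (t 2%:R) (t 1); t 2%:R].
pose v (s : 'S_3) := [:: s 0; s 1; s 2%:R].
have vl : map v l = [:: [:: 0; 1; 2%:R]; [:: 0; 2%:R; 1]; [:: 1; 0; 2%:R];
    [:: 1; 2%:R; 0]; [:: 2%:R; 0; 1]; [:: 2%:R; 1; 0]].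
  apply/eqP; rewrite /l /v /t /=.
  by rewrite !perm1 !permM /tperm !permE.
have ul : uniq l by apply: (@map_uniq _ _ v); rewrite vl.
have enl : perm_eq (enum 'S_3) l.
  have [|//|_ el] := @uniq_min_size _ l (enum 'S_3) ul.
  - by move=> s _; rewrite mem_enum.
  - by rewrite -cardE card_Sn.
  - by apply: uniq_perm => //; rewrite ?enum_uniq// => s; rewrite el.
rewrite -big_enum (perm_big _ enl) /=.
transitivity (\sum_(w <- map v l) F (nth 0 w 0) (nth 0 w 1) (nth 0 w 2)).
  by rewrite big_map.
by rewrite vl !big_cons big_nil /= addr0 !addrA.
Qed.

(** * The symmetrized kernel in terms of areas and side lengths *)

Section Curvature.
Set Implicit Arguments.
Unset Strict Implicit.
Local Open Scope classical_set_scope.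
Variable R : realType.
Implicit Types (h : R[i] -> R) (z : 'I_3 -> R[i]) (v w : R[i]).

Local Notation Re := complex.Re.
Local Notation Im := complex.Im.

Definition sqn v : R := Re v ^+ 2 + Im v ^+ 2.

(** The scalar product of the unit vector of argument [th] with [v]. *)
Definition proj (th : R) v : R := cos th * Re v + sin th * Im v.

(** Twice the signed area of the triangle. *)
Definition cross z : R :=
  Re (z 1 - z 0) * Im (z 2%:R - z 0) - Re (z 2%:R - z 0) * Im (z 1 - z 0).

(** The numerator of half the symmetrized kernel over the common denominator
    formed by the product of the squared side lengths. *)
Definition symm_numer h z : R :=
  proj (h (z 0)) (z 0 - z 1) * proj (h (z 0)) (z 0 - z 2%:R)
    * sqn (z 1 - z 2%:R)
  + proj (h (z 1)) (z 1 - z 0) * proj (h (z 1)) (z 1 - z 2%:R)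
    * sqn (z 0 - z 2%:R)
  + proj (h (z 2%:R)) (z 2%:R - z 0) * proj (h (z 2%:R)) (z 2%:R - z 1)
    * sqn (z 0 - z 1).

Lemma sqnC v w : sqn (v - w) = sqn (w - v).
Proof. by case: v w => [a b] [c d]; rewrite /sqn /=; ring. Qed.

Lemma sqn_gt0 v : v != 0 -> 0 < sqn v.
Proof.
case: v => a b; rewrite eq_complex /sqn /= => ab.
rewrite lt0r addr_ge0 ?sqr_ge0// andbT.
by rewrite paddr_eq0 ?sqr_ge0// !sqrf_eq0.
Qed.

Lemma normc_sqn v (r : R) : `|v| = r%:C%C -> sqn v = r ^+ 2.
Proof.
rewrite normc_def => -[<-].
by rewrite sqr_sqrtr// addr_ge0// sqr_ge0.
Qed.

Lemma Re_Kh h w v : Re (Kh h w v) = proj (h w) (w - v) / sqn (w - v).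
Proof.
rewrite /Kh; case: (w - v) => a b.
by rewrite /proj /sqn /expi /=; ring.
Qed.

Lemma collinear_cross z : collinear z -> cross z = 0.
Proof.
case=> a [[b1 b2] [_ H]]; rewrite /cross.
have [t0 ->] := H 0; have [t1 ->] := H 1; have [t2 ->] := H 2%:R.
by case: a {H} => a1 a2 /=; ring.
Qed.

(** If two of the three points agree, the line through the remaining two
    distinct values contains all three; if all agree, any line through the
    common value does. *)
Lemma noncollinear_inj z : ~ collinear z -> injective z.
Proof.
move=> ncz i j zij; apply: contrapT => ij; apply: ncz.
(* In Z/3 the three indices add up to 0, so k is the one other than i and j. *)
pose k : 'I_3 := - (i + j).
have zk l : z l = z i \/ z l = z k.
  suff : [|| l == i, l == j | l == k] by case/or3P => /eqP ->; auto.
  move/eqP: ij; rewrite {}/k {zij}; move: i j l.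
  by do 3!case=> [[|[|[|//]]] ?].
have [ik|ik] := eqVneq (z k) (z i).
  exists (z i), 1; split=> [|l]; first exact: oner_neq0.
  by exists 0; rewrite mul0r addr0; case: (zk l) => // ->.
exists (z i), (z k - z i); split=> [|l]; first by rewrite subr_eq0.
case: (zk l) => ->; first by exists 0; rewrite mul0r addr0.
by exists 1; rewrite mul1r addrC subrK.
Qed.

(** The classical formula [4 r Area = product of the side lengths], squared.
    With [p], [q] the sides at [z_0] and [a] the vector from [z_0] to the centre,
    being equidistant from the vertices means [2 <p, a> = |p|^2] and
    [2 <q, a> = |q|^2]. Cramer's rule gives [2 D a], and the squared norm of the
    solution is [|p|^2 |q|^2 |p - q|^2]. *)
Lemma circumradius_cross z : ~ collinear z ->
  4 * circumradius z ^+ 2 * cross z ^+ 2 =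
  sqn (z 0 - z 1) * sqn (z 0 - z 2%:R) * sqn (z 1 - z 2%:R).
Proof.
move=> /circumradiusP[o [_ H]].
have /normc_sqn := H 0; have /normc_sqn := H 1; have /normc_sqn := H 2%:R.
rewrite /cross; set r := circumradius z; rewrite /sqn.
case: (z 0) (z 1) (z 2%:R) o {H} => [x0 y0] [x1 y1] [x2 y2] [a b] /=.
move: (r) => {}r H2 H1 H0.
have E0 : r ^+ 2 = (x0 - a) ^+ 2 + (y0 - b) ^+ 2 by rewrite H0.
have F1 : (x1 - x0) ^+ 2 + (y1 - y0) ^+ 2 =
    2 * ((x1 - x0) * (a - x0) + (y1 - y0) * (b - y0)) by lra.
have F2 : (x2 - x0) ^+ 2 + (y2 - y0) ^+ 2 =
    2 * ((x2 - x0) * (a - x0) + (y2 - y0) * (b - y0)) by lra.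
set D := _ - _ * _.
have Da : 2 * D * (a - x0) =
    ((x1 - x0) ^+ 2 + (y1 - y0) ^+ 2) * (y2 - y0)
    - ((x2 - x0) ^+ 2 + (y2 - y0) ^+ 2) * (y1 - y0).
  by rewrite /D F1 F2; ring.
have Db : 2 * D * (b - y0) =
    ((x2 - x0) ^+ 2 + (y2 - y0) ^+ 2) * (x1 - x0)
    - ((x1 - x0) ^+ 2 + (y1 - y0) ^+ 2) * (x2 - x0).
  by rewrite /D F1 F2; ring.
transitivity ((2 * D * (a - x0)) ^+ 2 + (2 * D * (b - y0)) ^+ 2).
  by rewrite E0; ring.
by rewrite Da Db; ring.
Qed.

(** The product of the side lengths does not vanish, so neither does the area, by
    [circumradius_cross]; the rest is the quotient of [S[Re K_h]] by [c^2]. *)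
Lemma Rh_symm_numer h z : ~ collinear z ->
  cross z != 0 /\ Rh h z = symm_numer h z / (2 * cross z ^+ 2) - 2^-1.
Proof.
move=> ncz; have zi := noncollinear_inj ncz.
have E := circumradius_cross ncz.
have n01 : sqn (z 0 - z 1) != 0.
  by rewrite gt_eqF// sqn_gt0// subr_eq0; apply/eqP => /zi.
have n02 : sqn (z 0 - z 2%:R) != 0.
  by rewrite gt_eqF// sqn_gt0// subr_eq0; apply/eqP => /zi.
have n12 : sqn (z 1 - z 2%:R) != 0.
  by rewrite gt_eqF// sqn_gt0// subr_eq0; apply/eqP => /zi.
have D0 : cross z != 0.
  apply/eqP => D0; have : sqn (z 0 - z 1) * sqn (z 0 - z 2%:R)
      * sqn (z 1 - z 2%:R) != 0 by rewrite !mulf_neq0.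
  by rewrite -E D0 expr0n mulr0 eqxx.
split=> //; rewrite /Rh /menger_curvature; congr (_ - _).
have -> : Re (symm_form (ReK (Kh h)) z) =
    \sum_(s : 'S_3) Re (Kh h (z (s 0)) (z (s 1)))
                  * Re (Kh h (z (s 0)) (z (s 2%:R))).
  rewrite /symm_form raddf_sum; apply: eq_bigr => s _.
  by rewrite /ReK /=; ring.
rewrite (sum_perm3 _ (fun i j k =>
  Re (Kh h (z i) (z j)) * Re (Kh h (z i) (z k)))).
rewrite !Re_Kh !(sqnC (z 1) (z 0)) !(sqnC (z 2%:R)).
have -> : (circumradius z)^-1 ^+ 2 = 4 * cross z ^+ 2 /
    (sqn (z 0 - z 1) * sqn (z 0 - z 2%:R) * sqn (z 1 - z 2%:R)).
  rewrite -E exprVn; have r0 : circumradius z != 0.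
    apply/eqP => r0; move: E; rewrite r0 expr0n mulr0 mul0r => /esym/eqP.
    by rewrite !mulf_eq0 !(negPf n01, negPf n02, negPf n12).
  by field; rewrite ?r0 ?D0.
rewrite /symm_numer.
by field; rewrite ?D0 ?n01 ?n02 ?n12.
Qed.

(** For a constant unit vector [u] the numerator is the squared area: both sides
    are homogeneous of degree 2 in [u], and the polynomial identity carries the
    factor [|u|^2 = 1]. *)
Lemma Rh_const h (c : R) z : (forall w, h w = c) -> ~ collinear z -> Rh h z = 0.
Proof.
move=> hc ncz; have [D0 ->] := Rh_symm_numer h ncz.
suff -> : symm_numer h z = cross z ^+ 2 by field.
have := cos2Dsin2 c; rewrite /symm_numer /proj !hc /cross /sqn.
case: (z 0) (z 1) (z 2%:R) => [x0 y0] [x1 y1] [x2 y2] /=.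
move: (cos c) (sin c) => C S CS.
transitivity ((C ^+ 2 + S ^+ 2) *
  ((x1 - x0) * (y2 - y0) - (x2 - x0) * (y1 - y0)) ^+ 2).
  by ring.
by rewrite CS mul1r.
Qed.

(** * Continuity along lines *)

Lemma continuous_line (u v : R[i]) :
  continuous (fun t : R => u + t%:C%C * v : R[i]^o).
Proof.
move=> t.
have c : (x%:C%C : R[i]^o) @[x --> t] --> (t%:C%C : R[i]^o).
  apply/cvgrPdist_lt => e e0.
  have [e1 [e10 ->]] : exists e1 : R, 0 < e1 /\ e = e1%:C%C.
    case: e e0 => e1 e2; rewrite ltcE /= => /andP[/eqP -> e10].
    by exists e1.
  near=> x; rewrite -rmorphB normc_def /= expr0n addr0 sqrtr_sqr ltcR.
  by near: x; exact: cvgr_dist_lt.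
exact: (@cvgD R[i] R[i]^o R (nbhs t) _ (fun=> u) (fun x => x%:C%C * v)
  u (t%:C%C * v) (cvg_cst _) (cvgM c (cvg_cst _))).
Unshelve. all: by end_near. Qed.

Lemma continuous_Re_line (u v : R[i]) :
  continuous (fun t : R => Re (u + t%:C%C * v)).
Proof.
have -> : (fun t : R => Re (u + t%:C%C * v)) = (fun t => Re u + t * Re v).
  by apply/funext => t; case: u v => [a b] [c d] /=; ring.
move=> t; apply: cvgD; first exact: cvg_cst.
by apply: cvgM; [exact: cvg_id|exact: cvg_cst].
Qed.

Lemma continuous_Im_line (u v : R[i]) :
  continuous (fun t : R => Im (u + t%:C%C * v)).
Proof.
have -> : (fun t : R => Im (u + t%:C%C * v)) = (fun t => Im u + t * Im v).
  by apply/funext => t; case: u v => [a b] [c d] /=; ring.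
move=> t; apply: cvgD; first exact: cvg_cst.
by apply: cvgM; [exact: cvg_id|exact: cvg_cst].
Qed.

Definition triple (a b c : R[i]) : 'I_3 -> R[i] :=
  fun j => nth 0 [:: a; b; c] j.

Section ContinuousPhase.
Variable h : R[i]^o -> R.
Hypothesis hcont : continuous h.

Lemma continuous_h_line (u v : R[i]) :
  continuous (fun t : R => h (u + t%:C%C * v)).
Proof.
move=> t; apply: (@continuous_comp R R[i]^o R _ h t); last exact: hcont.
exact: continuous_line.
Qed.

Lemma continuous_symm_numer (a b u v : R[i]) :
  continuous (fun t : R => symm_numer h (triple a b (u + t%:C%C * v))).
Proof.
move=> t; pose p (x : R) : R[i] := u + x%:C%C * v.
have cp : h (p x) @[x --> t] --> h (p t) by exact: continuous_h_line.
have ccos : cos (h (p x)) @[x --> t] --> cos (h (p t)).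
  by apply: (@continuous_comp R R R _ cos t); [exact: cp|exact: continuous_cos].
have csin : sin (h (p x)) @[x --> t] --> sin (h (p t)).
  by apply: (@continuous_comp R R R _ sin t); [exact: cp|exact: continuous_sin].
have pB q x : p x - q = (u - q) + x%:C%C * v by rewrite /p; ring.
have Bp q x : q - p x = (q - u) + x%:C%C * - v by rewrite /p; ring.
have csqn q : sqn (q - p x) @[x --> t] --> sqn (q - p t).
  under eq_fun do rewrite Bp; rewrite Bp /sqn.
  by apply: cvgD; apply: cvgM;
    (exact: continuous_Re_line || exact: continuous_Im_line).
have cproj q : proj (h (p x)) (p x - q) @[x --> t] --> proj (h (p t)) (p t - q).
  under eq_fun do rewrite pB; rewrite pB /proj.
  apply: cvgD; apply: cvgM; [exact: ccos|exact: continuous_Re_line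
    |exact: csin|exact: continuous_Im_line].
have cproj0 th q : proj th (q - p x) @[x --> t] --> proj th (q - p t).
  under eq_fun do rewrite Bp; rewrite Bp /proj.
  apply: cvgD; apply: cvgM; [exact: cvg_cst|exact: continuous_Re_line
    |exact: cvg_cst|exact: continuous_Im_line].
rewrite /symm_numer /triple /=.
apply: cvgD; first apply: cvgD.
- by apply: cvgM; [apply: cvgM; [exact: cvg_cst|exact: cproj0]|exact: csqn].
- by apply: cvgM; [apply: cvgM; [exact: cvg_cst|exact: cproj0]|exact: csqn].
- by apply: cvgM; [apply: cvgM; exact: cproj|exact: cvg_cst].
Qed.

(** * Collinear triples *)

(** The bracket is the defect of affinity of [<u, d>^2] along the line, at the
    parameters 0, 1 and [s]. *)
Lemma symm_numer_line (a d : R[i]) (s : R) :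
  symm_numer h (triple a (a + d) (a + s%:C%C * d)) =
  s * (1 - s) * sqn d * ((1 - s) * proj (h a) d ^+ 2
    + s * proj (h (a + d)) d ^+ 2 - proj (h (a + s%:C%C * d)) d ^+ 2).
Proof.
rewrite /symm_numer /triple /= /proj /sqn.
move: (h a) (h (a + d)) (h (a + s%:C%C * d)) => t0 t1 t2.
move: (cos t0) (sin t0) (cos t1) (sin t1) (cos t2) (sin t2) => *.
by case: a d => [a1 a2] [d1 d2] /=; ring.
Qed.

(** Moving the third point by [e] times the normal vector [i d] makes a collinear
    triple non-collinear as soon as [e] is nonzero. *)
Lemma cross_bump (a d : R[i]) (s e : R) :
  cross (triple a (a + d) (a + s%:C%C * d + e%:C%C * (0 +i* 1 * d)%C)) =
  e * sqn d.
Proof.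
rewrite /cross /triple /sqn /=.
by case: a d => [a1 a2] [d1 d2] /=; ring.
Qed.

Section BoundedR.
Variable C : R.
Hypothesis RhC : forall z, ~ collinear z -> `|Rh h z| <= C.

Lemma symm_numer_le z : cross z != 0 ->
  `|symm_numer h z| <= (2 * C + 1) * cross z ^+ 2.
Proof.
move=> D0; have ncz : ~ collinear z by move/collinear_cross/eqP; apply/negP.
have [_ E] := Rh_symm_numer h ncz; have := RhC ncz.
have -> : symm_numer h z = (2 * Rh h z + 1) * cross z ^+ 2 by rewrite E; field.
rewrite normrM (ger0_norm (sqr_ge0 _)) => RC.
rewrite ler_wpM2r ?sqr_ge0//.
by rewrite (le_trans (ler_normD _ _))// normrM normr1 normr_nat lerD2r
  ler_pM2l.
Qed.

(** By [symm_numer_le], the numerator is of order [e^2] when the third point is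
    at distance of order [e] from the line; let [e] tend to 0. *)
Lemma symm_numer_collinear (a d : R[i]) (s : R) : d != 0 ->
  symm_numer h (triple a (a + d) (a + s%:C%C * d)) = 0.
Proof.
move=> d0.
pose z e := triple a (a + d) (a + s%:C%C * d + e%:C%C * (0 +i* 1 * d)%C).
pose F (e : R) := (2 * C + 1) * ((e * sqn d) * (e * sqn d))
  - `|symm_numer h (z e)|.
have F_ge0 e : e != 0 -> 0 <= F e.
  move=> e0; rewrite subr_ge0 -expr2 -(cross_bump a d s).
  by apply: symm_numer_le; rewrite cross_bump mulf_neq0// gt_eqF// sqn_gt0.
have F0 : F e @[e --> 0^'] --> F 0.
  apply: cvg_within_filter; apply: cvgB.
    apply: cvgM; first exact: cvg_cst.
    by apply: cvgM; apply: cvgM; [exact: cvg_id|exact: cvg_cst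
      |exact: cvg_id|exact: cvg_cst].
  by apply: cvg_norm; exact: continuous_symm_numer.
have : 0 <= F 0.
  apply: (closed_cvg _ (@closed_ge _ 0) _ _ F0).
  by near=> e; apply: F_ge0; near: e; exact: nbhs_dnbhs_neq.
rewrite /F mul0r !mulr0 sub0r oppr_ge0 normr_le0 => /eqP <-.
by rewrite /z mul0r addr0.
Unshelve. all: by end_near. Qed.

(** The function [<u, d>^2] is affine along the line, by [symm_numer_line], and
    nonnegative everywhere, so its slope is zero. *)
Lemma proj_line (a d : R[i]) : proj (h (a + d)) d ^+ 2 = proj (h a) d ^+ 2.
Proof.
have [->|d0] := eqVneq d 0; first by rewrite addr0.
set g1 := LHS; set g0 := RHS; apply: contrapT => g10.
(* The affine function with values g0 at 0 and g1 at 1 takes the value -1 at s. *)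
pose s := (g0 + 1) / (g0 - g1).
have g01 : g0 - g1 != 0 by rewrite subr_eq0 eq_sym; apply/eqP.
have := @symm_numer_collinear a d s d0; rewrite symm_numer_line -/g0 -/g1.
have G s' : 0 <= proj (h (a + s'%:C%C * d)) d ^+ 2 by exact: sqr_ge0.
have g0p : 0 < g0 + 1 by rewrite ltr_wpDl// sqr_ge0.
have g1p : 0 < g1 + 1 by rewrite ltr_wpDl// sqr_ge0.
have s0 : s != 0 by rewrite mulf_neq0 ?invr_neq0// gt_eqF.
have s1 : 1 - s != 0.
  have -> : 1 - s = - (g1 + 1) / (g0 - g1) by rewrite /s; field.
  by rewrite mulf_neq0 ?invr_neq0// oppr_eq0 gt_eqF.
have K0 : s * (1 - s) * sqn d != 0.
  by apply: mulf_neq0; [exact: mulf_neq0|rewrite gt_eqF// sqn_gt0].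
move/eqP; rewrite mulf_eq0 (negPf K0) /=.
have -> : (1 - s) * g0 + s * g1 = - 1 by rewrite /s; field.
by move/eqP; have := G s; lra.
Qed.

Lemma proj_line_dir (a : R[i]) (t : R) (d : R[i]) :
  proj (h (a + t%:C%C * d)) d ^+ 2 = proj (h a) d ^+ 2.
Proof.
have [->|t0] := eqVneq t 0; first by rewrite mul0r addr0.
have projZ th : proj th (t%:C%C * d) = t * proj th d.
  by case: d => x y; rewrite /proj /=; ring.
have := proj_line a (t%:C%C * d); rewrite !projZ !exprMn.
by apply: mulfI; rewrite expf_neq0.
Qed.

(** * Constancy of the phase *)

(** With [C + i S] and [C' + i S'] the unit vectors at [a] and [b], the claim
    squared is [S^2 C'^2 + S'^2 C^2 - 2 (C S) (C' S') = 0], which follows from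
    [C^2 = C'^2] and [C S = C' S']. For the former, join [a] to [b] by a
    horizontal and a vertical segment; along these [C^2] and [S^2 = 1 - C^2] are
    constant. For the latter use the directions [1 + i] and [1 - i], along which
    [(C + S)^2 = 1 + 2 C S] and [(C - S)^2 = 1 - 2 C S] are constant. *)
Lemma sin_subr_eq0 (a b : R[i]) : sin (h a - h b) = 0.
Proof.
have E : b = a + (Re (b - a))%:C%C * (1 +i* 0)%C
    + (Im (b - a))%:C%C * (0 +i* 1)%C.
  case: a b => [a1 a2] [b1 b2]; apply/eqP; rewrite eq_complex /=.
  by apply/andP; split; apply/eqP; ring.
have E' : b = a + ((Re (b - a) + Im (b - a)) / 2)%:C%C * (1 +i* 1)%C
    + ((Re (b - a) - Im (b - a)) / 2)%:C%C * (1 +i* (-1))%C.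
  case: a b {E} => [a1 a2] [b1 b2]; apply/eqP; rewrite eq_complex /=.
  by apply/andP; split; apply/eqP; field.
have sq (x : R) : sin x ^+ 2 = 1 - cos x ^+ 2.
  by rewrite -(cos2Dsin2 x) addrAC subrr add0r.
have cc : cos (h b) ^+ 2 = cos (h a) ^+ 2.
  set c := a + (Re (b - a))%:C%C * (1 +i* 0)%C in E.
  have := proj_line_dir c (Im (b - a)) (0 +i* 1)%C; rewrite -E.
  have := proj_line_dir a (Re (b - a)) (1 +i* 0)%C; rewrite -/c /proj /=.
  by rewrite !mulr0 !mulr1 !addr0 !add0r !sq => E1 E2; lra.
have cs : cos (h b) * sin (h b) = cos (h a) * sin (h a).
  set c := a + ((Re (b - a) + Im (b - a)) / 2)%:C%C * (1 +i* 1)%C in E'.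
  have := proj_line_dir c ((Re (b - a) - Im (b - a)) / 2) (1 +i* (-1))%C.
  have := proj_line_dir a ((Re (b - a) + Im (b - a)) / 2) (1 +i* 1)%C.
  rewrite -E' -/c /proj /=.
  have := cos2Dsin2 (h a); have := cos2Dsin2 (h b); have := cos2Dsin2 (h c).
  by nra.
apply/eqP; rewrite -sqrf_eq0 sinB; apply/eqP.
transitivity (sin (h a) ^+ 2 * cos (h b) ^+ 2 + sin (h b) ^+ 2 * cos (h a) ^+ 2
  - 2 * ((cos (h a) * sin (h a)) * (cos (h b) * sin (h b)))); first by ring.
by rewrite cs -expr2 exprMn !sq cc; ring.
Qed.

End BoundedR.

(** If [h(a) < h(b)], then on the segment from [a] to [b] the function [h] takes
    a value [m] with [0 < m - h(a) < pi], where the sine is positive. *)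
Lemma constant_of_sin_eq0 : (forall a b, sin (h a - h b) = 0) ->
  forall a b, h a = h b.
Proof.
move=> h0; have le a b : h b <= h a.
  rewrite leNgt; apply/negP => ab.
  pose f (t : R) := h (a + t%:C%C * (b - a)).
  have f0 : f 0 = h a by rewrite /f mul0r addr0.
  have f1 : f 1 = h b by rewrite /f mul1r addrC subrK.
  have fc : continuous f by exact: continuous_h_line.
  have pi0 : 0 < pi :> R := pi_gt0 R.
  pose m := Num.min (h b) (h a + pi / 2).
  have am : h a < m by rewrite lt_min ab ltrDl divr_gt0.
  have mb : m <= h b by rewrite ge_min lexx.
  have mpi : m <= h a + pi / 2 by rewrite ge_min lexx orbT.
  have [||c _ fcm] := @IVT _ f 0 1 m ler01.
  - exact: continuous_subspaceT.
  - by rewrite f0 f1 min_l ?max_r ?(ltW ab)// (ltW am).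
  have := h0 (a + c%:C%C * (b - a)) a; rewrite -/(f c) fcm => sm.
  by have := @sin_gt0_pi _ (m - h a); rewrite sm ltxx => /(_ _)/negP; apply; lra.
by move=> a b; apply/eqP; rewrite eq_le !le.
Qed.

End ContinuousPhase.

End Curvature.

Theorem theorem2p3 (R : realType) (h : R[i]^o -> R) (hcont : continuous h) :
  [<-> exists C : R, forall z : 'I_3 -> R[i], ~ collinear z -> `|Rh h z| <= C;
       forall z : 'I_3 -> R[i], ~ collinear z -> Rh h z = 0;
       exists c : R, forall w : R[i], h w = c].
Proof.
have bounded_const (C : R) :
    (forall z : 'I_3 -> R[i], ~ collinear z -> `|Rh h z| <= C) ->
    exists c : R, forall w : R[i], h w = c.
  move=> hC; exists (h 0) => w.
  apply: (constant_of_sin_eq0 hcont) => a b.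
  exact: (sin_subr_eq0 hcont hC a b).
tfae.
- by move=> [C /bounded_const[c hc]] z ncz; rewrite (Rh_const hc ncz).
- by move=> h0; apply: (bounded_const 0) => z /h0 ->; rewrite normr0.
- by move=> [c hc]; exists 0 => z ncz; rewrite (Rh_const hc ncz) normr0.
Qed.
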